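(* Let $m,n\ge1$ be integers, $\mathcal{F}\in\mathtt{S}^m(\mathbb{C}^{n+1})$, and let $g\in\mathbb{C}[x]=\mathbb{C}[x_1,\ldots,x_n]$ be a polynomial of degree $k=\deg(g)\le m$. Then $g$ is a generating polynomial for $\mathcal{F}$ if and only if its homogenization $\tilde g(\tilde x):=x_0^k\,g(x/x_0)$ is apolar to $\mathcal{F}$ (i.e. $\tilde g\in\mathrm{Ann}(\mathcal{F})$).
   Context: $\mathtt{S}^m(\mathbb{C}^{n+1})$ is the space of symmetric tensors $\mathcal{F}=(\mathcal{F}_{i_1\ldots i_m})_{0\le i_1,\ldots,i_m\le n}$ with complex entries. Write $x=(x_1,\ldots,x_n)$, $\tilde x=(x_0,x_1,\ldots,x_n)$, $|\alpha|=\alpha_1+\cdots+\alpha_n$, $\mathbb{N}^n_k=\{\alpha\in\mathbb{N}^n:|\alpha|\le k\}$, and $\mathbb{C}[x]_m$ for the polynomials of degree at most $m$. For $\alpha\in\mathbb{N}^n_m$, $\mathcal{F}_\alpha:=\mathcal{F}_{i_1\ldots i_m}$ whenever $x_{i_1}\cdots x_{i_m}=x^\alpha$ with $x_0:=1$. For $p=\sum_{\alpha\in\mathbb{N}^n_m}p_\alpha x^\alpha$, $\langle p,\mathcal{F}\rangle:=\sum_{\alpha\in\mathbb{N}^n_m}p_\alpha\mathcal{F}_\alpha$. A polynomial $g\in\mathbb{C}[x]_m$ is a generating polynomial for $\mathcal{F}$ if $\langle g\cdot x^\beta,\mathcal{F}\rangle=0$ for all $\beta\in\mathbb{N}^n_{m-\deg(g)}$.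 The tensor $\mathcal{F}$ determines the form $\mathcal{F}(\tilde x):=\sum_{0\le i_1,\ldots,i_m\le n}\mathcal{F}_{i_1\ldots i_m}x_{i_1}\cdots x_{i_m}$. For $p=\sum_\theta p_\theta x_0^{\theta_0}\cdots x_n^{\theta_n}\in\mathbb{C}[\tilde x]$, put $p\circ\mathcal{F}:=\sum_\theta p_\theta\,\dfrac{\partial^{\theta_0+\cdots+\theta_n}}{\partial x_0^{\theta_0}\cdots\partial x_n^{\theta_n}}\mathcal{F}(\tilde x)$. The polynomial $p$ is apolar to $\mathcal{F}$ if $p\circ\mathcal{F}=0$ identically, and $\mathrm{Ann}(\mathcal{F})=\{p\in\mathbb{C}[\tilde x]:p\circ\mathcal{F}=0\}$. *)

(* Defs.v *)
From mathcomp Require Import all_boot all_order all_algebra.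
From mathcomp Require Import perm fraction.
From mathcomp Require Import mpoly complex reals.

Set Implicit Arguments.
Unset Strict Implicit.
Unset Printing Implicit Defensive.

Import GRing.Theory.
Local Open Scope ring_scope.

(* The space S^m(K^(n+1)): the index (i_1, ..., i_m) is an m-tuple over
   'I_n.+1 = {0, ..., n}. *)
Record sym_tensor (K : Type) (m n : nat) := SymTensor {
  tensor_entry :> m.-tuple 'I_n.+1 -> K;
  tensor_sym : forall (s : 'S_m) (t : m.-tuple 'I_n.+1),
    tensor_entry [tuple tnth t (s i) | i < m] = tensor_entry t
}.

(* In the polynomials in n variables, 'X_j with j : 'I_n is x_(j+1). In those
   in n.+1 variables, 'X_ord0 is x_0 and 'X_(lift ord0 j) is x_(j+1). *)

(* x_i for 0 <= i <= n, under the convention x_0 := 1. *)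
Definition affine_var {K : comNzRingType} {n : nat} (i : 'I_n.+1) :
    {mpoly K[n]} :=
  if unlift ord0 i is Some j then 'X_j else 1.

(* F_alpha := F_(i_1 ... i_m) for any index such that
   x_(i_1) ... x_(i_m) = x^alpha; independence of the index is
   tensor_coefE below. The value 0 only occurs for |alpha| > m. *)
Definition tensor_coef {K : comNzRingType} {m n : nat} (F : sym_tensor K m n)
    (a : 'X_{1..n}) : K :=
  if [pick t : m.-tuple 'I_n.+1
        | \prod_(i <- t) affine_var i == 'X_[a] :> {mpoly K[n]}] is Some t
  then F t else 0.

Definition pairing {K : comNzRingType} {m n : nat} (p : {mpoly K[n]})
    (F : sym_tensor K m n) : K :=
  \sum_(a : 'X_{1..n < m.+1}) p@_a * tensor_coef F a.

(* The zero polynomial gets degree 0. *)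
Definition tdeg {K : comNzRingType} {n : nat} (p : {mpoly K[n]}) : nat :=
  (msize p).-1.

Definition generating_poly {K : comNzRingType} {m n : nat}
    (F : sym_tensor K m n) (g : {mpoly K[n]}) : Prop :=
  (tdeg g <= m)%N /\
  forall b : 'X_{1..n}, (mdeg b <= m - tdeg g)%N -> pairing (g * 'X_[b]) F = 0.

Definition tensor_form {K : comNzRingType} {m n : nat}
    (F : sym_tensor K m n) : {mpoly K[n.+1]} :=
  \sum_(t : m.-tuple 'I_n.+1) F t *: \prod_(i <- t) 'X_i.

Definition diff_act {K : comNzRingType} {m n : nat} (p : {mpoly K[n.+1]})
    (F : sym_tensor K m n) : {mpoly K[n.+1]} :=
  \sum_(a <- msupp p) p@_a *: (tensor_form F)^`M[a].

Definition apolar {K : comNzRingType} {m n : nat} (F : sym_tensor K m n)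
    (p : {mpoly K[n.+1]}) : Prop :=
  diff_act p F = 0.

(* x_0^k g(x / x_0) with k = deg g, expanded monomial by monomial; the
   defining identity in the fraction field is homogenizationE below. *)
Definition homogenization {K : comNzRingType} {n : nat} (g : {mpoly K[n]}) :
    {mpoly K[n.+1]} :=
  \sum_(a <- msupp g) g@_a *:
    ('X_ord0 ^+ (tdeg g - mdeg a) * \prod_(j < n) 'X_(lift ord0 j) ^+ a j).

Lemma prod_affine_var (K : comNzRingType) (n : nat) (s : seq 'I_n.+1) :
  \prod_(i <- s) affine_var i =
    'X_[[multinom count_mem (lift ord0 j) s | j < n]] :> {mpoly K[n]}.
Proof.
elim: s => [|i s IHs].
  by rewrite big_nil -mpolyX0; congr mpolyX; apply/mnmP=> j; rewrite mnm0E mnmE.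
rewrite big_cons IHs /affine_var; case: unliftP => [k ->|->] /=.
  rewrite -mpolyXD; congr mpolyX; apply/mnmP=> j; rewrite mnmDE mnm1E !mnmE.
  by rewrite (inj_eq lift_inj).
by rewrite mul1r; congr mpolyX; apply/mnmP=> j; rewrite !mnmE.
Qed.

Lemma tensor_coefE (K : comNzRingType) (m n : nat) (F : sym_tensor K m n)
    (a : 'X_{1..n}) (t : m.-tuple 'I_n.+1) :
  \prod_(i <- t) affine_var i = 'X_[a] :> {mpoly K[n]} -> tensor_coef F a = F t.
Proof.
move=> ta; rewrite /tensor_coef; case: pickP => [u /eqP ua|/(_ t)]; last first.
  by rewrite ta eqxx.
have inj_X (b c : 'X_{1..n}) : 'X_[b] = 'X_[c] :> {mpoly K[n]} -> b = c.
  move/(congr1 (mcoeff b)); rewrite !mcoeffX eqxx; case: eqP => // _ /eqP.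
  by rewrite oner_eq0.
have count_lift j : count_mem (lift ord0 j) u = count_mem (lift ord0 j) t.
  by move: ua; rewrite -ta !prod_affine_var => /inj_X/mnmP/(_ j); rewrite !mnmE.
have size_count (v : m.-tuple 'I_n.+1) :
    (count_mem ord0 v + \sum_(j < n) count_mem (lift ord0 j) v)%N = m.
  transitivity (\sum_(i < n.+1) count_mem i v)%N; first by rewrite big_ord_recl.
  rewrite -[RHS](size_tuple v) -sum1_size.
  rewrite (eq_bigr (fun i => \sum_(j <- v) if j == i then 1 else 0)%N); last first.
    by move=> i _; rewrite -sum1_count big_mkcond.
  rewrite exchange_big; apply: eq_bigr => i _.
  by rewrite -big_mkcond (eq_bigl (pred1 i)) ?big_pred1_eq // => j; rewrite eq_sym.
have /tuple_permP[s /val_inj ->] : perm_eq u t; last exact: tensor_sym.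
apply/allP => i _ /=; apply/eqP; case: (unliftP ord0 i) => [j ->|->] //.
apply/eqP; rewrite -(eqn_add2r (\sum_(j < n) count_mem (lift ord0 j) t)%N).
rewrite size_count -(eq_bigr _ (fun j _ => count_lift j)).
by rewrite size_count.
Qed.

Lemma homogenizationE (K : idomainType) (n : nat) (g : {mpoly K[n]}) :
  tofrac (homogenization g) =
    tofrac 'X_ord0 ^+ tdeg g *
    mmap (fun c => tofrac c%:MP)
         (fun j : 'I_n => tofrac 'X_(lift ord0 j) / tofrac 'X_ord0) g.
Proof.
have X0_neq0 : tofrac ('X_ord0 : {mpoly K[n.+1]}) != 0.
  by rewrite tofrac_eq0 -msize_poly_eq0 msizeX.
rewrite /homogenization raddf_sum /= /mmap big_distrr /= !big_seq.
apply: eq_bigr => a /msize_mdeg_lt lt_a.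
rewrite -mul_mpolyC !rmorphM /= [RHS]mulrCA /mmap1 rmorph_prod rmorphXn /=.
congr (_ * _); under [in RHS]eq_bigr do rewrite exprMn exprVn.
rewrite big_split /= prodfV prodrXr -mdegE [RHS]mulrCA [RHS]mulrC.
congr (_ * _); last by apply: eq_bigr => j _; rewrite rmorphXn.
by rewrite expfB_cond // (negbTE X0_neq0) add0n /tdeg; case: (msize g) lt_a.
Qed.

(* Main.v *)
Require Import Defs.
From mathcomp Require Import all_boot all_order all_algebra.
From mathcomp Require Import ssrcomplements mpoly complex reals.

(** Write T(alpha) for the affine coefficient F_alpha, L = x_0 + ... + x_n, and
    theta' for the exponents of x_1, ..., x_n in a monomial x^theta.

    Expanding L ^ m over m-tuples of indices produces x^theta once for every
    tuple with product x^theta; on these tuples F takes the single value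
    T(theta'). Hence the form of F is L ^ m with its coefficient at theta
    multiplied by T(theta') ([mcoeff_tensor_form]). Differentiating a monomial
    only shifts its exponent, so for |a| = k the coefficient of d^a F at c is
    the one of d^a (L ^ m) at c, times T(a' + c'). The point of comparing with
    L ^ m is that every d/dx_i acts on powers of L in the same way, whence
    d^a (L ^ m) = m (m-1) ... (m-k+1) L ^ (m-k) depends on a only through k
    ([mderivm_sumX]). As the monomials of the homogenization of g all have
    degree k and restrict to those of g, summing over them gives
      coefficient of (g~ o F) at c
        = m (m-1) ... (m-k+1) * [L ^ (m-k)]_c * <g x^c', F>
    ([mcoeff_diff_act_homogenization]).

    In characteristic 0 the scalar in front is nonzero exactly when
    |c| = m - k ([mcoeff_sumX_neq0]), and then c' runs over all exponents of
    degree at most m - k. So all these coefficients vanish if and only if all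
    the pairings defining a generating polynomial do. *)

Set Implicit Arguments.
Unset Strict Implicit.
Unset Printing Implicit Defensive.

Import GRing.Theory Num.Theory.
Local Open Scope ring_scope.

(** * Exponents of affine monomials and of their homogenizations *)

Section Exponents.

Variable n : nat.
Implicit Types (a b : 'X_{1..n}) (c : 'X_{1..n.+1}).

Definition dehom_mnm c : 'X_{1..n} := [multinom c (lift ord0 j) | j < n].

(** The exponent of x_0 ^ k (x / x_0) ^ a; the truncated subtraction makes it
    wrong when |a| > k. *)
Definition hom_mnm k a : 'X_{1..n.+1} :=
  [multinom if unlift ord0 i is Some j then a j else (k - mdeg a)%N | i < n.+1].

Lemma dehom_mnmD c c' : dehom_mnm (c + c') = (dehom_mnm c + dehom_mnm c')%MM.
Proof. by apply/mnmP=> j; rewrite !(mnmE, mnmDE). Qed.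

Lemma hom_mnmK k : cancel (hom_mnm k) dehom_mnm.
Proof. by move=> a; apply/mnmP=> j; rewrite !mnmE liftK. Qed.

Lemma mdeg_dehom_mnm c : (mdeg (dehom_mnm c) <= mdeg c)%N.
Proof.
rewrite !mdegE big_ord_recl (eq_bigr (fun j => c (lift ord0 j))) ?leq_addl //.
by move=> j _; rewrite mnmE.
Qed.

Lemma mdeg_hom_mnm k a : (mdeg a <= k)%N -> mdeg (hom_mnm k a) = k.
Proof.
move=> le_ak; rewrite mdegE big_ord_recl mnmE unlift_none.
rewrite (eq_bigr (fun j => a j)) => [|j _]; last by rewrite mnmE liftK.
by rewrite -mdegE subnK.
Qed.

End Exponents.

Lemma mpolyX_inj (K : nzRingType) n : injective (@mpolyX n K).
Proof.
move=> b c /(congr1 (mcoeff b)); rewrite !mcoeffX eqxx.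
by case: eqP => // _ /eqP; rewrite oner_eq0.
Qed.

Lemma prod_mpolyX_count (K : comNzRingType) n (s : seq 'I_n) :
  \prod_(i <- s) 'X_i =
    'X_[[multinom count_mem i s | i < n]] :> {mpoly K[n]}.
Proof.
rewrite mprodXE; congr mpolyX; apply/mnmP=> i; rewrite mnm_sumE mnmE.
rewrite -sum1_count [RHS]big_mkcond /=.
by apply: eq_bigr => j _; rewrite mnm1E; case: eqP.
Qed.

Lemma prod_affine_dehom (K : comNzRingType) n (s : seq 'I_n.+1) c :
  \prod_(i <- s) 'X_i = 'X_[c] :> {mpoly K[n.+1]} ->
  \prod_(i <- s) affine_var i = 'X_[dehom_mnm c] :> {mpoly K[n]}.
Proof.
rewrite prod_mpolyX_count prod_affine_var => /mpolyX_inj <-.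
by congr mpolyX; apply/mnmP=> j; rewrite !mnmE.
Qed.

Lemma homogenizationX (K : comNzRingType) n (g : {mpoly K[n]}) :
  homogenization g =
    \sum_(a <- msupp g) g@_a *: 'X_[hom_mnm (tdeg g) a].
Proof.
apply: eq_bigr => a _; congr (_ *: _).
rewrite [RHS]mpolyXE_id big_ord_recl mnmE unlift_none; congr (_ * _).
by apply: eq_bigr => j _; rewrite mnmE liftK.
Qed.

Lemma leq_mdeg_tdeg (K : comNzRingType) n (g : {mpoly K[n]}) a :
  a \in msupp g -> (mdeg a <= tdeg g)%N.
Proof. by move/msize_mdeg_lt; rewrite /tdeg; case: (msize g). Qed.

(** * Linear extension from monomials *)

Section LinearExtension.

Variables (K : comNzRingType) (n : nat) (V : lmodType K).
Implicit Types (p : {mpoly K[n]}) (w : 'X_{1..n} -> V).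

Lemma sum_msupp_bounded p w d : (msize p <= d)%N ->
  \sum_(a <- msupp p) p@_a *: w a = \sum_(a : 'X_{1..n < d}) p@_a *: w a.
Proof.
move=> le_pd; pose I : subFinType _ := 'X_{1..n < d}.
rewrite (big_mksub I) ?msupp_uniq //=; last first.
  by move=> a /msize_mdeg_lt /leq_trans; apply.
by rewrite big_rmcond //= => a /memN_msupp_eq0 ->; rewrite scale0r.
Qed.

(** Allows a linear functional to be evaluated on a combination of monomials
    that may contain repetitions or zero coefficients. *)
Lemma sum_mcoeff_linear (T : eqType) (r : seq T) (k : T -> K)
    (h : T -> 'X_{1..n}) p w d :
  {in r, forall x, (mdeg (h x) < d)%N} ->
  p = \sum_(x <- r) k x *: 'X_[h x] ->
  \sum_(a : 'X_{1..n < d}) p@_a *: w a = \sum_(x <- r) k x *: w (h x).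
Proof.
move=> lt_hd ->.
under eq_bigr do rewrite raddf_sum scaler_suml.
rewrite exchange_big /= !big_seq; apply: eq_bigr => x /lt_hd lt_hx.
rewrite (bigD1 (BMultinom lt_hx)) //= mcoeffZ mcoeffX eqxx mulr1.
rewrite big1 ?addr0 // => a ne_ax; rewrite mcoeffZ mcoeffX.
case: eqP => [eq_xa|_]; last by rewrite mulr0 scale0r.
by case/eqP: ne_ax; apply: val_inj.
Qed.

End LinearExtension.

Lemma pairing_mulX (K : comNzRingType) (m n : nat) (F : sym_tensor K m n)
    (g : {mpoly K[n]}) (b : 'X_{1..n}) :
  (tdeg g + mdeg b <= m)%N ->
  pairing (g * 'X_[b]) F =
    \sum_(a <- msupp g) g@_a * tensor_coef F (a + b)%MM.
Proof.
move=> le_gbm.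
apply: (sum_mcoeff_linear (V := K^o) (tensor_coef F)) => [a|].
  move=> /leq_mdeg_tdeg le_ag; rewrite ltnS mdegD.
  by apply: leq_trans le_gbm; rewrite leq_add2r.
rewrite {1}[g]mpolyE mulr_suml; apply: eq_bigr => a _.
by rewrite -scalerAl -mpolyXD.
Qed.

Lemma diff_act_homogenization (K : comNzRingType) (m n : nat)
    (F : sym_tensor K m n) (g : {mpoly K[n]}) :
  diff_act (homogenization g) F =
    \sum_(a <- msupp g) g@_a *: (tensor_form F)^`M[hom_mnm (tdeg g) a].
Proof.
rewrite /diff_act.
(* The bound covers both the support of the homogenization and the exponents
   hom_mnm (tdeg g) a, which have degree tdeg g. *)
rewrite (@sum_msupp_bounded _ _ _ _ (fun a => (tensor_form F)^`M[a])
          _ (leq_maxl _ (tdeg g).+1)).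
apply: (sum_mcoeff_linear (fun a => (tensor_form F)^`M[a]));
  last exact: homogenizationX.
by move=> a /leq_mdeg_tdeg le_ag; rewrite mdeg_hom_mnm // leq_max leqnn orbT.
Qed.

(** * Powers of the sum of the variables *)

Section SumX.

Variables (K : comNzRingType) (n : nat).
Implicit Types (a c : 'X_{1..n}).

Let L : {mpoly K[n]} := \sum_(i < n) 'X_i.

Lemma sumX_exp_tuples d : L ^+ d = \sum_(t : d.-tuple 'I_n) \prod_(i <- t) 'X_i.
Proof.
rewrite -[in LHS](card_ord d) -prodr_const /L bigA_distr_bigA /=.
rewrite (reindex (@tuple_of_finfun 'I_n d)) /=; last first.
  by apply: onW_bij; exists (@finfun_of_tuple 'I_n d);
     [exact: tuple_of_finfunK | exact: finfun_of_tupleK].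
by apply: eq_bigr => f _; rewrite big_map big_enum.
Qed.

Lemma mderiv_sumX_exp i d : (L ^+ d)^`M(i) = L ^+ d.-1 *+ d.
Proof.
have dL : L^`M(i) = 1.
  rewrite /L raddf_sum (bigD1 i) //= mderivX mnm1E eqxx scale1r.
  rewrite -{1}[U_(i)%MM]add0m addmK mpolyX0.
  rewrite big1 ?addr0 // => j /negPf ne_ji.
  by rewrite mderivX mnm1E ne_ji scale0r.
elim: d => [|d IHd]; first by rewrite expr0 -mpolyC1 mderivC mulr0n.
rewrite exprS mderivM dL mul1r IHd mulrnAr -exprS mulrS.
by case: d {IHd} => [|d]; rewrite ?mulr0n.
Qed.

(** All the d/dx_i send L ^ d to d L ^ (d-1), so that only the order of a
    differential monomial matters for its action on a power of L. *)
Lemma mderivm_sumX a d : (L ^+ d)^`M[a] = L ^+ (d - mdeg a) *+ d ^_ (mdeg a).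
Proof.
move ak: (mdeg a) => k; elim: k a ak => [|k IHk] a ak.
  move/eqP: ak; rewrite mdeg_eq0 => /eqP ->.
  by rewrite mderivm0m subn0 ffactn0 mulr1n.
have [i ai_gt0] : exists i, (0 < a i)%N.
  apply/existsP; apply: contraPT (ak); rewrite negb_exists => /forallP a0.
  by rewrite mdegE big1 // => i _; move: (a0 i); rewrite -eqn0Ngt => /eqP.
have aE : a = (a - U_(i) + U_(i))%MM by rewrite submK // lep1mP -lt0n.
have ak' : mdeg (a - U_(i))%MM = k.
  by move: ak; rewrite {1}aE mdegD mdeg1 addn1 => -[].
rewrite aE mderivmDm mderivmU1m IHk // mderivMn mderiv_sumX_exp -mulrnA.
by rewrite ffactnSr mulnC subnS.
Qed.

Lemma mcoeff_sumX_deg c d : mdeg c != d -> (L ^+ d)@_c = 0.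
Proof.
apply: dhomog_nemf_coeff; rewrite -[d in d.-homog]mul1n; apply: dhomogMn.
by apply: rpred_sum => i _; rewrite dhomogX /= mdeg1.
Qed.

End SumX.

(** Applying d^c to L ^ d with d = |c| leaves the constant d!, which is also
    c! times the coefficient in question. *)
Lemma mcoeff_sumX_neq0 (K : numDomainType) n (c : 'X_{1..n}) :
  ((\sum_(i < n) 'X_i : {mpoly K[n]}) ^+ mdeg c)@_c != 0.
Proof.
have := congr1 (mcoeff 0%MM) (mderivm_sumX K c (mdeg c)).
rewrite mcoeff_mderivm addm0 subnn ffactnn mcoeffMn expr0 mcoeff1 eqxx.
move=> cE; apply/eqP=> c0; move/eqP: cE; rewrite c0 mul0rn eq_sym pnatr_eq0.
by rewrite eqn0Ngt fact_gt0.
Qed.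

(** * The form of a symmetric tensor *)

Section TensorForm.

Variables (K : comNzRingType) (m n : nat) (F : sym_tensor K m n).

Let L : {mpoly K[n.+1]} := \sum_(i < n.+1) 'X_i.

(** The coefficient of L ^ m counts the tuples of indices with product x^c, and
    by symmetry F is constant on them. *)
Lemma mcoeff_tensor_form c :
  (tensor_form F)@_c = (L ^+ m)@_c * tensor_coef F (dehom_mnm c).
Proof.
rewrite sumX_exp_tuples !raddf_sum mulr_suml /=; apply: eq_bigr => t _.
rewrite mcoeffZ mulrC.
have [tc|tNc] := eqVneq (\prod_(i <- t) 'X_i : {mpoly K[n.+1]}) 'X_[c].
  by rewrite (tensor_coefE F (prod_affine_dehom tc)).
have -> : (\prod_(i <- t) 'X_i : {mpoly K[n.+1]})@_c = 0.
  move: tNc; rewrite prod_mpolyX_count mcoeffX.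
  by case: (_ =P c) => // ->; rewrite eqxx.
by rewrite !mul0r.
Qed.

Lemma mcoeff_mderivm_tensor_form a c :
  (tensor_form F)^`M[a]@_c =
    (L ^+ m)^`M[a]@_c * tensor_coef F (dehom_mnm a + dehom_mnm c)%MM.
Proof.
by rewrite !mcoeff_mderivm mcoeff_tensor_form dehom_mnmD mulrnAl.
Qed.

(** Every derivative of order tdeg g sends L ^ m to the same multiple of
    L ^ (m - tdeg g), which can therefore be factored out of the sum over the
    monomials of g; what remains is the pairing. The bound on c keeps
    g * x^c' within the degrees that the pairing sees. *)
Lemma mcoeff_diff_act_homogenization (g : {mpoly K[n]}) c :
  (tdeg g + mdeg (dehom_mnm c) <= m)%N ->
  (diff_act (homogenization g) F)@_c =
    (L ^+ (m - tdeg g))@_c *+ m ^_ (tdeg g) *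
    pairing (g * 'X_[dehom_mnm c]) F.
Proof.
move=> le_gcm; rewrite pairing_mulX // diff_act_homogenization.
rewrite raddf_sum mulr_sumr /= !big_seq.
apply: eq_bigr => a /leq_mdeg_tdeg le_ag.
rewrite mcoeffZ mcoeff_mderivm_tensor_form hom_mnmK mderivm_sumX.
by rewrite mdeg_hom_mnm // mcoeffMn mulrCA.
Qed.

Lemma diff_act_homogenization_deg (g : {mpoly K[n]}) c :
  mdeg c != (m - tdeg g)%N -> (diff_act (homogenization g) F)@_c = 0.
Proof.
move=> ne_c; rewrite diff_act_homogenization raddf_sum /= big_seq big1 //.
move=> a /leq_mdeg_tdeg le_ag.
rewrite mcoeffZ mcoeff_mderivm_tensor_form mderivm_sumX mdeg_hom_mnm //.
by rewrite mcoeffMn mcoeff_sumX_deg // mul0rn mul0r mulr0.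
Qed.

End TensorForm.

Theorem proposition2p2 (R : realType) (m n : nat) (hm : (0 < m)%N)
    (hn : (0 < n)%N) (F : sym_tensor R[i] m n) (g : {mpoly R[i][n]})
    (hg : (tdeg g <= m)%N) :
  generating_poly F g <-> apolar F (homogenization g).
Proof.
split=> [[_ gen_g]|apolar_g].
  apply/mpolyP=> c; rewrite mcoeff0.
  have [deg_c|] := eqVneq (mdeg c) (m - tdeg g)%N; last first.
    exact: diff_act_homogenization_deg.
  have le_c : (mdeg (dehom_mnm c) <= m - tdeg g)%N.
    by rewrite -deg_c mdeg_dehom_mnm.
  rewrite mcoeff_diff_act_homogenization ?gen_g ?mulr0 //.
  by rewrite -leq_subRL.
(* Every b of degree at most m - tdeg g dehomogenizes an exponent of degree
   exactly m - tdeg g, where the power of L has a nonzero coefficient. *)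
split=> // b le_b; have deg_c := mdeg_hom_mnm le_b.
have := congr1 (mcoeff (hom_mnm (m - tdeg g) b)) apolar_g.
rewrite mcoeff_diff_act_homogenization hom_mnmK ?mcoeff0; last first.
  by rewrite -leq_subRL.
move/eqP; rewrite mulf_eq0 -mulr_natr mulf_eq0.
have := mcoeff_sumX_neq0 R[i] (hom_mnm (m - tdeg g) b).
rewrite deg_c => /negPf ->; rewrite pnatr_eq0 eqn0Ngt ffact_gt0 hg /=.
by move/eqP.
Qed.
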